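(* (1) The sequence of growth orders $\{[\gamma_{J_m}],\ m\ge 2\}$ is a decreasing monotonic sequence, i.e. $[\gamma_{J_{m+1}}]<[\gamma_{J_m}]$ for all $m\ge2$. (2) The sequence of growth functions $\{\gamma_{J_m},\ m\ge 2\}$ tends pointwise to the function $n\mapsto (n+1)(n+2)/2$ as $m\to+\infty$. (3) The automaton $J'$ is similar to a pointwise limit of the sequence $\{J_m,\ m\ge 2\}$, and it defines the monoid with presentation $$S_{J'}=\langle\, e,f_0,f_1 \mid f_0f_1^pf_0=f_0,\ p\ge 0;\ \ f_0f_1^p=f_0f_1,\ p\ge 1\,\rangle$$ with growth function $\gamma_{S_{J'}}(n)=3n$, $n\ge 1$. Moreover, the growth function of a pointwise limit of the automaton sequence does not coincide with the pointwise limit of the growth function sequence.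
   Context: For $m\ge 2$ let $X_m=\{x_0,\ldots,x_{m-1}\}$, and let $X^\omega$ denote the set of right-infinite words over an alphabet $X$. $J_m$ is the Mealy automaton over $X_m$ with three states $e,f_0,f_1$, which define the following transformations of $X_m^\omega$ (for all $w$): $e$ is the identity; $f_0(x_i w)=x_0 w$ for $0\le i\le m-2$ and $f_0(x_{m-1}w)=x_0 f_0(w)$; $f_1(x_i w)=x_{i+1}w$ for $0\le i\le m-2$ and $f_1(x_{m-1}w)=x_0 f_1(w)$ (the state reached after reading the first letter is the one whose transformation acts on the rest of the word). The automaton $J'$ has states $e,f_0,f_1$ and the infinite alphabet $X'=\{x_{-1},x_0,x_1,x_2,\ldots\}$: $e$ is the identity; $f_0(x_iw)=x_0w$ for $i\ge 0$ and $f_0(x_{-1}w)=x_0f_0(w)$; $f_1(x_iw)=x_{i+1}w$ for $i\ge 0$ and $f_1(x_{-1}w)=x_0f_1(w)$. Similarity: two Mealy automata with transition functions $\pi_1,\pi_2$ and output functions $\lambda_1,\lambda_2$ are similar if there are bijections $\xi$ between their alphabets and $\theta$ between their state sets with $\theta\pi_1(x,f)=\pi_2(\xi x,\theta f)$ and $\xi\lambda_1(x,f)=\lambda_2(\xi x,\theta f)$ for all letters $x$ and states $f$. Similar automata are identified when passing to a limit: a pointwise limit of $\{J_m\}$ is an automaton over $X_\infty=\{x_0,x_1,x_2,\ldots\}$ with states $e,f_0,f_1$ for which there exist automata $J_m'$ over $X_m\subset X_\infty$, with $J'_m$ similar to $J_m$ for each $m$, such that for each letter $x\in X_\infty$ and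 each state $f$ the values of the transition and output functions of $J_m'$ at $(x,f)$ are eventually constant in $m$ and equal to those of the limit automaton. (The paper uses $J_m'$ obtained from $J_m$ by the cyclic permutation $\xi(x_i)=x_{i+1 \bmod m}$ and $\theta=\mathrm{id}$, and identifies $X'$ with $X_\infty$ by $x_i\leftrightarrow x_{i+1}$.) For an automaton $A\in\{J_m,J'\}$ or the limit automaton, $S_A$ is the monoid of transformations generated by $e,f_0,f_1$ under composition (products act from right to left, $f^0=e$); $\ell(e)=0$, and for $s\neq e$, $\ell(s)$ is the least number of generators in a product equal to $s$; $\gamma_{S_A}(n)=|\{s\in S_A:\ell(s)\le n\}|$. The growth function $\gamma_A(n)$ of the automaton is the number of states of the minimal automaton equivalent to the $n$-th power of $A$, i.e. the number of distinct transformations $g_1\cdots g_n$ with $g_j\in\{e,f_0,f_1\}$; $\gamma_A(0)=1$. Growth orders: for positive functions $\gamma_1,\gamma_2$ of a natural argument, $\gamma_1\preceq\gamma_2$ means that there exist $C_1,C_2,N_0\in\mathbb N$ with $\gamma_1(n)\le C_1\gamma_2(C_2n)$ for all $n\ge N_0$; $\gamma_1\sim\gamma_2$ means $\gamma_1\preceq\gamma_2$ and $\gamma_2\preceq\gamma_1$; $\gamma_1\prec\gamma_2$ means $\gamma_1\preceq\gamma_2$ and $\gamma_1\not\sim\gamma_2$. $[\gamma]$ is the $\sim$-class of $\gamma$, and $[\gamma_1]<[\gamma_2]$ means $\gamma_1\prec\gamma_2$. *)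

(* Defs.v *)
From mathcomp Require Import all_boot finmap.
From mathcomp Require Import all_classical topology.

Set Implicit Arguments.
Unset Strict Implicit.
Unset Printing Implicit Defensive.

Local Open Scope classical_set_scope.

Record mealy (X Q : Type) := Mealy {
  trans : X -> Q -> Q;
  out : X -> Q -> X
}.

Section Transformations.
Variables (X Q : Type) (A : mealy X Q).

(* A right-infinite word over X is a function nat -> X.  [state_at q w n] is
   the state reached from q after reading w 0, ..., w (n - 1). *)
Fixpoint state_at (q : Q) (w : nat -> X) (n : nat) : Q :=
  if n is k.+1 then trans A (w k) (state_at q w k) else q.

Definition transf (q : Q) (w : nat -> X) : nat -> X :=
  fun n => out A (w n) (state_at q w n).

(* Products act from right to left: [:: g1; ...; gn] denotes the
   transformation w |-> g1 (... (gn w)). *)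
Definition product (u : seq Q) : (nat -> X) -> (nat -> X) :=
  foldr (fun q s => transf q \o s) id u.

Definition products (n : nat) : set ((nat -> X) -> (nat -> X)) :=
  [set product u | u in [set u | size u = n]].

Definition monoid_of : set ((nat -> X) -> (nat -> X)) := range product.

(* Least number of generators in a product equal to s (irrelevant value 0 when
   s is not in the monoid).  The empty product gives the identity length 0. *)
Definition length_in (s : (nat -> X) -> (nat -> X)) : nat :=
  if pselect (exists n, `[< products n s >]) is left h then ex_minn h else 0.

End Transformations.

(* [fset_set] sends an infinite set to the empty one; the two sets below are
   finite when Q is finite, since there are finitely many words of size n.
   The minimal automaton equivalent to the n-th power of A has one state for
   each distinct product of n states of A. *)
Definition growth (X : choiceType) (Q : Type) (A : mealy X Q) (n : nat) : nat :=
  #|` fset_set (products A n)|.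

Definition monoid_growth (X : choiceType) (Q : Type) (A : mealy X Q)
    (n : nat) : nat :=
  #|` fset_set [set s | monoid_of A s /\ length_in A s <= n]|.

Definition growth_le (g1 g2 : nat -> nat) : Prop :=
  exists C1 C2 N0 : nat, forall n, N0 <= n -> g1 n <= C1 * g2 (C2 * n).

Definition growth_equiv (g1 g2 : nat -> nat) : Prop :=
  growth_le g1 g2 /\ growth_le g2 g1.

Definition growth_lt (g1 g2 : nat -> nat) : Prop :=
  growth_le g1 g2 /\ ~ growth_equiv g1 g2.

Definition similar (X1 X2 Q1 Q2 : Type) (A1 : mealy X1 Q1) (A2 : mealy X2 Q2) :
    Prop :=
  exists (xi : X1 -> X2) (theta : Q1 -> Q2),
    [/\ bijective xi, bijective theta,
        forall x q, theta (trans A1 x q) = trans A2 (xi x) (theta q) &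
        forall x q, xi (out A1 x q) = out A2 (xi x) (theta q)].

(* The alphabet {x_0, ..., x_{m-1}} is 'I_m, and {x_0, x_1, ...} is nat; the
   former embeds in the latter by [val]. *)
Definition pointwise_limit (Q : Type) (A : forall m, mealy 'I_m Q)
    (L : mealy nat Q) : Prop :=
  exists B : forall m, mealy 'I_m Q,
    (forall m, 2 <= m -> similar (A m) (B m)) /\
    (forall (i : nat) (q : Q), \forall m \near \oo,
       exists x : 'I_m, [/\ val x = i, trans (B m) x q = trans L i q &
                            val (out (B m) x q) = out L i q]).

(* Least congruence on the free monoid (seq Q, ++) containing R. *)
Inductive congr (Q : Type) (R : seq Q -> seq Q -> Prop) :
    seq Q -> seq Q -> Prop :=
| congr_base u v : R u v -> congr R u v
| congr_refl u : congr R u u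
| congr_sym u v : congr R u v -> congr R v u
| congr_trans u v w : congr R u v -> congr R v w -> congr R u w
| congr_cat u u' v v' :
    congr R u u' -> congr R v v' -> congr R (u ++ v) (u' ++ v').

Definition congr_class (Q : Type) (R : seq Q -> seq Q -> Prop) (u : seq Q) :
    set (seq Q) :=
  [set v | congr R u v].

(* The quotient of the free monoid on the states by [congr R] is isomorphic to
   the monoid of A, each generator corresponding to its transformation. *)
Definition has_presentation (X Q : Type) (A : mealy X Q)
    (R : seq Q -> seq Q -> Prop) : Prop :=
  exists phi : set (seq Q) -> ((nat -> X) -> (nat -> X)),
    [/\ set_bij (range (congr_class R)) (monoid_of A) phi,
        phi (congr_class R [::]) = id,
        forall u v, phi (congr_class R (u ++ v)) =
                    phi (congr_class R u) \o phi (congr_class R v) &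
        forall q, phi (congr_class R [:: q]) = transf A q].

Inductive jstate := Je | Jf0 | Jf1.

Definition ord_zero (m : nat) (x : 'I_m) : 'I_m :=
  Ordinal (leq_ltn_trans (leq0n x) (ltn_ord x)).

(* [ordS] is the cyclic successor: x_i |-> x_{i+1}, x_{m-1} |-> x_0. *)
Definition J (m : nat) : mealy 'I_m jstate := {|
  trans (x : 'I_m) q := if x.+1 == m then q else Je;
  out (x : 'I_m) q := match q with
             | Je => x
             | Jf0 => ord_zero x
             | Jf1 => ordS x
             end
|}.

(* Letters of {x_{-1}, x_0, x_1, ...}: x_{-1} is None, x_i is Some i. *)
Definition Jprime : mealy (option nat) jstate := {|
  trans x q := if x is None then q else Je;
  out x q := match q, x with
             | Je, _ => x
             | Jf0, _ => Some 0
             | Jf1, Some i => Some i.+1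
             | Jf1, None => Some 0
             end
|}.

(* The generator e denotes the unit of the presented monoid, hence [rel_unit];
   the power f1^0 = e is the empty word. *)
Inductive Jprime_rel : seq jstate -> seq jstate -> Prop :=
| rel_unit : Jprime_rel [:: Je] [::]
| rel_absorb p : Jprime_rel (Jf0 :: nseq p Jf1 ++ [:: Jf0]) [:: Jf0]
| rel_power p : 1 <= p -> Jprime_rel (Jf0 :: nseq p Jf1) [:: Jf0; Jf1].

(* Main.v *)
Require Import Defs.
From mathcomp Require Import all_boot finmap.
From mathcomp Require Import all_classical topology.
From mathcomp Require Import zify.

(** The automaton [J m] acts on the digits, in base [m], of the natural numbers:
    [Jf1] adds 1, and [Jf0] sends [m ^ v * (m * y + r) - 1] with [0 < r < m]
    to [m ^ v.+1 * y].  Since a transformation reads its input from left to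
    right and the digit sequences of natural numbers realize all finite
    prefixes, this action is faithful ([product_eqP]), and all questions about
    the monoid of [J m] become arithmetic.

    Write [k] for the number of factors [Jf0] in a product.  After [j] of them
    acting in normal form, the current value is a multiple of [m ^ j]; so [Jf0]
    after a translation by [a] either acts, when [m ^ j] divides [a + 1], as one
    more level, or merely as the translation by [f0_nat a].  Hence every product
    reduces, without getting longer, to
      [f1^a f0 f1^(m^(k-1) c_(k-1) - 1) f0 ... f0 f1^(m c_1 - 1) f0 f1^(c_0 - 1)]
    with all [c_i > 0] ([form_word_surj]).  Its length is [a + sum_i m^i c_i].
    Distinct such words act differently ([form_word_inj]): with [K] large, the
    values at [m ^ K - t] stay above [m ^ K] as long as [t < c_0], and drop to a
    bounded value at [t = c_0], so [c_0] is visible, and so on level by level.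
    Therefore [growth (J m) n] is exactly the number of pairs [(a, c)] with
    [a + sum_i m^i c_i <= n] ([growth_J]).

    This count visibly decreases with [m].  For [m > n] only [k <= 1] is
    possible, and the count is [(n + 1)(n + 2) / 2].  For strictness in the
    growth orders, put [T k = 1 + ... + k].  There are at least [m ^ T k] forms
    of weight [k m^k] in base [m]; since [(m + 1)^j >= m^(j + j %/ m^2)], the
    number of forms of weight below [m ^ L] in base [m + 1] has an exponent
    that falls short of [T L] by a quadratic amount in [L], whereas the factors
    [C1], [C2] and [k] can be made to cost less than that.

    For the limit automaton the words [f1^p], [f1^p f0], [f1^p f0 f1] are normal
    forms for the presented monoid and act differently on three explicit words,
    which gives the presentation and the growth [3 n].  At [n = 3] this is 9,
    while the limit of the growth functions is 10. *)

Local Open Scope classical_set_scope.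

(** * Transformations of a Mealy automaton *)

Section MealyWords.
Variables (X Q : Type) (A : mealy X Q).

Lemma product_cat (u v : seq Q) :
  product A (u ++ v) = product A u \o product A v.
Proof. by elim: u => //= q u ->. Qed.

Lemma state_at_prefix q (w w' : nat -> X) n :
  (forall i, i < n -> w i = w' i) -> state_at A q w n = state_at A q w' n.
Proof.
elim: n => //= n IH eqw; rewrite (eqw n) // IH // => i lt_in.
by apply: eqw; apply: ltnW.
Qed.

(** Continuity of the transformations: it reduces the equality of two products to
    a set of words that realizes every finite prefix. *)
Lemma product_prefix u (w w' : nat -> X) n :
  (forall i, i < n -> w i = w' i) ->
  forall i, i < n -> product A u w i = product A u w' i.
Proof.
move=> eqw; elim: u => //= q u IH i lt_in.
rewrite /transf IH //; congr out; apply: state_at_prefix => j lt_ji.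
by apply: IH; apply: ltn_trans lt_in.
Qed.

(** An identity state pads a product, so that the products of exactly [n] states
    are also those of at most [n] states. *)
Lemma product_nseq_id q k :
  (forall w, transf A q w = w) -> product A (nseq k q) = id.
Proof. by move=> idq; elim: k => //= k ->; apply: funext => w; rewrite /= idq. Qed.

Lemma transf0 q w :
  transf A q w 0 = out A (w 0) q.
Proof. by []. Qed.

Lemma transfS q w n :
  transf A q w n.+1 = transf A (trans A (w 0) q) (fun i => w i.+1) n.
Proof.
have stateS k : state_at A q w k.+1 = state_at A (trans A (w 0) q) (fun i => w i.+1) k.
  by elim: k => //= k ->.
by rewrite /transf stateS.
Qed.

Lemma transf_identity q :
  (forall x, trans A x q = q) -> (forall x, out A x q = x) ->
  forall w, transf A q w = w.
Proof.
move=> stay copy w; apply: funext => n; rewrite /transf.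
have -> : state_at A q w n = q by elim: n => //= n ->.
exact: copy.
Qed.

End MealyWords.

(** * The action of J_m on the natural numbers *)

Section Odometer.
Variable m : nat.
Hypothesis m_gt1 : 1 < m.

Let m_gt0 : 0 < m := ltnW m_gt1.

(** The length of the initial run of digits [m - 1] of [x], which is also the
    largest [v] with [m ^ v] dividing [x + 1]; it is less than [x + 1], hence
    within the range of the search. *)
Definition carry_len (x : nat) : nat :=
  find (fun i => ~~ (m ^ i.+1 %| x.+1)) (iota 0 x.+1).

(** [Jf0] clears the initial run of digits [m - 1] and the digit after it. *)
Definition f0_nat (x : nat) : nat :=
  m ^ (carry_len x).+1 * (x %/ m ^ (carry_len x).+1).

Definition act1 (q : jstate) (x : nat) : nat :=
  match q with Je => x | Jf0 => f0_nat x | Jf1 => x.+1 end.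

Definition act (u : seq jstate) (x : nat) : nat := foldr act1 x u.

Lemma act_cat u v x : act (u ++ v) x = act u (act v x).
Proof. exact: foldr_cat. Qed.

Lemma act_nseq a x : act (nseq a Jf1) x = a + x.
Proof. by elim: a => //= a ->. Qed.

(** The exponent [v] is the number of trailing zeros of [x] and [r] its first
    nonzero digit.  Every computation with [f0_nat] below starts from this
    decomposition of the successor of its argument. *)
Lemma carry_decomp x : 0 < x ->
  exists v y r, [/\ 0 < r, r < m & x = m ^ v * (m * y + r)].
Proof.
have [n] := ubnP x; elim: n x => // n IH x lt_xn x_gt0.
have [/dvdnP[z def_x]|ndv] := boolP (m %| x).
  have [||v [y [r [r0 rm def_z]]]] := IH z; [nia|nia|].
  by exists v.+1, y, r; split=> //; rewrite def_x def_z expnS; lia.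
exists 0, (x %/ m), (x %% m); rewrite ltn_mod m_gt0 lt0n; split=> //.
by rewrite expn0 mul1n mulnC -divn_eq.
Qed.

Lemma dvdn_carry v y r i : 0 < r -> r < m ->
  (m ^ i %| m ^ v * (m * y + r)) = (i <= v).
Proof.
move=> r_gt0 r_lt; have [le_iv|lt_vi] := leqP i v.
  by apply: dvdn_mulr; apply: dvdn_exp2l.
apply/negbTE/negP => /(dvdn_trans (dvdn_exp2l m lt_vi)).
rewrite expnSr dvdn_pmul2l ?expn_gt0 ?m_gt0 //.
rewrite dvdn_addr ?dvdn_mulr // => /(dvdn_leq r_gt0); lia.
Qed.

Lemma carry_lenE v y r : 0 < r -> r < m ->
  carry_len (m ^ v * (m * y + r)).-1 = v.
Proof.
move=> r_gt0 r_lt; rewrite /carry_len prednK; last first.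
  by rewrite muln_gt0 expn_gt0 m_gt0 /= addn_gt0 r_gt0 orbT.
set x := _ * _; rewrite (eq_find (a2 := fun i => v <= i)); last first.
  by move=> i; rewrite /= dvdn_carry // -ltnNge ltnS.
have lt_vx : v < x.
  by apply: leq_trans (ltn_expl v m_gt1) _; rewrite leq_pmulr // addn_gt0 r_gt0 orbT.
have -> : iota 0 x = iota 0 v ++ v :: iota v.+1 (x - v.+1).
  have -> : x = v + (x - v) by lia.
  rewrite iotaD add0n; congr cat; have -> : v + (x - v) - v.+1 = (x - v).-1 by lia.
  by case: (x - v) (subn_gt0 v x) => //; rewrite lt_vx.
rewrite find_cat /= leqnn size_iota addn0.
by rewrite (_ : has _ _ = false) //; apply/hasPn => i; rewrite mem_iota; lia.
Qed.

Lemma f0_natE v y r : 0 < r -> r < m ->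
  f0_nat (m ^ v * (m * y + r)).-1 = m ^ v.+1 * y.
Proof.
move=> r_gt0 r_lt; rewrite /f0_nat carry_lenE //; congr muln.
have pv : 0 < m ^ v by rewrite expn_gt0 m_gt0.
have -> : (m ^ v * (m * y + r)).-1 = y * m ^ v.+1 + (m ^ v * r).-1.
  by rewrite expnS; nia.
by rewrite divnMDl ?expn_gt0 ?m_gt0 // divn_small ?addn0 // expnS; nia.
Qed.

Definition digits (x : nat) : nat -> 'I_m :=
  fun n => Ordinal (ltn_pmod (x %/ m ^ n) m_gt0).

Lemma digits_inj : injective digits.
Proof.
move=> x; have [n] := ubnP x; elim: n x => // n IH x lt_xn y eq_xy.
have eq0 : x %% m = y %% m.
  by have /(congr1 val) := congr1 (@^~ 0) eq_xy; rewrite /= expn0 !divn1.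
have eqD : digits (x %/ m) = digits (y %/ m).
  apply: funext => i; apply: val_inj; have /(congr1 val) := congr1 (@^~ i.+1) eq_xy.
  by rewrite /= -!divnMA -expnS.
have [x0|x_gt0] := posnP x; last first.
  rewrite (divn_eq x m) (divn_eq y m) eq0 (IH (x %/ m) _ _ eqD) //.
  by apply: leq_trans (ltn_Pdiv m_gt1 x_gt0) _.
have : forall i, y %/ m ^ i %% m = 0.
  move=> i; have /(congr1 val) := congr1 (@^~ i) eq_xy.
  by rewrite /= x0 div0n mod0n => <-.
rewrite x0 => y0; apply/esym/eqP; rewrite -leqn0 leqNgt; apply/negP => y_gt0.
have [v [z [r [r0 rm def_y]]]] := carry_decomp _ y_gt0.
have := y0 v; rewrite def_y mulKn ?expn_gt0 ?m_gt0 // mulnC modnMDl modn_small //; lia.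
Qed.

Lemma digits_prefix (w : nat -> 'I_m) n :
  exists x, forall i, i < n -> digits x i = w i.
Proof.
elim: n w => [|n IH] w; first by exists 0.
have [x eq_x] := IH (fun i => w i.+1).
exists (x * m + w 0) => -[|i] lt_in; apply: val_inj => /=.
  by rewrite expn0 divn1 modnMDl modn_small.
rewrite expnS divnMA divnMDl // (divn_small (ltn_ord _)) addn0; exact: (congr1 val (eq_x i lt_in)).
Qed.

(** [Jf0] and [Jf1] propagate in the same way: both remain active as long as
    only digits [m - 1] are read, that is, as long as adding 1 carries. *)
Lemma state_at_digits q x n :
  state_at (J m) q (digits x) n = if m ^ n %| x.+1 then q else Je.
Proof.
elim: n => [|n IH] /=; first by rewrite expn0 dvd1n.
rewrite IH; have [/dvdnP[y def_x]|ndv] := boolP (m ^ n %| x.+1); last first.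
  rewrite if_same; case: ifP => // /(dvdn_trans (dvdn_exp2l m (leqnSn n))).
  by rewrite (negbTE ndv).
have pn : 0 < m ^ n by rewrite expn_gt0 m_gt0.
have y_gt0 : 0 < y by nia.
have -> : x %/ m ^ n = y.-1.
  have -> : x = y.-1 * m ^ n + (m ^ n).-1 by nia.
  by rewrite divnMDl // divn_small ?addn0 // prednK.
rewrite def_x expnSr [y * _]mulnC dvdn_pmul2l //.
congr (if _ then _ else _).
have def_y : y = y.-1 %/ m * m + (y.-1 %% m).+1.
  by rewrite addnS -divn_eq prednK.
rewrite [in RHS]def_y dvdn_addr ?dvdn_mull //.
have := ltn_pmod y.-1 m_gt0; rewrite leq_eqVlt => /orP[/eqP-> | lt_rm].
  by rewrite eqxx dvdnn.
by rewrite gtnNdvd // ltn_eqF.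
Qed.

Lemma transf_digits q x : transf (J m) q (digits x) = digits (act1 q x).
Proof.
apply: funext => n; apply: val_inj; rewrite /transf state_at_digits.
have pn : 0 < m ^ n by rewrite expn_gt0 m_gt0.
case: q => /=; first by rewrite if_same.
  have [v [y [r [r0 rm def_x]]]] := carry_decomp x.+1 isT.
  have -> : x = (m ^ v * (m * y + r)).-1 by rewrite -def_x.
  rewrite f0_natE // prednK -?def_x // def_x dvdn_carry //.
  have [le_nv|lt_vn] := leqP n v => /=.
    have -> : v.+1 = n + (v - n).+1 by lia.
    by rewrite expnD -mulnA mulKn // expnS -mulnA modnMr.
  have -> : n = v.+1 + (n - v.+1) by lia.
  rewrite expnD !divnMA mulKn ?expn_gt0 ?m_gt0 //; congr (_ %/ _ %% _).
  have pv : 0 < m ^ v by rewrite expn_gt0 m_gt0.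
  have -> : (m ^ v * (m * y + r)).-1 = y * m ^ v.+1 + (m ^ v * r).-1.
    by rewrite expnS; nia.
  by rewrite divnMDl ?expn_gt0 ?m_gt0 // divn_small ?addn0 // expnS; nia.
rewrite divnS //; case: ifP => _ /=; last by rewrite add0n.
by rewrite add1n -addn1 modnDml addn1.
Qed.

Lemma product_digits u x : product (J m) u (digits x) = digits (act u x).
Proof. by elim: u => //= q u ->; rewrite transf_digits. Qed.

(** Faithfulness.  Two products with the same action on the natural numbers agree
    on all digit sequences of numbers, and these realize every finite prefix. *)
Lemma product_eqP u v :
  product (J m) u = product (J m) v <-> act u =1 act v.
Proof.
split=> [eq_uv x|eq_uv].
  by apply: digits_inj; rewrite -!product_digits eq_uv.
apply: funext => w; apply: funext => n.
have [x eq_x] := digits_prefix w n.+1.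
rewrite -(product_prefix _ _ (J m) u _ _ n.+1 eq_x) //.
by rewrite -(product_prefix _ _ (J m) v _ _ n.+1 eq_x) // !product_digits eq_uv.
Qed.

End Odometer.

(** * Normal forms in the monoid of J_m *)

Section NormalForms.
Variable m : nat.
Hypothesis m_gt1 : 1 < m.

Let m_gt0 : 0 < m := ltnW m_gt1.
Let pow_gt0 k : 0 < m ^ k. Proof. by rewrite expn_gt0 m_gt0. Qed.

Notation act := (act m).
Notation f0_nat := (f0_nat m).

Fixpoint weight (c : seq nat) : nat :=
  if c is c0 :: c1 then c0 + m * weight c1 else 0.

(** The part of a normal form to the right of its leading power of [Jf1]; the
    head of [c] is the rightmost exponent, which acts first.  The index [j] is
    the level of that exponent: the word is meant to act on multiples of
    [m ^ j], so that [m ^ j * c0 - 1] is the general translation after which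
    [Jf0] clears [j.+1] digits or more. *)
Fixpoint tail_word (j : nat) (c : seq nat) : seq jstate :=
  if c is c0 :: c1 then tail_word j.+1 c1 ++ Jf0 :: nseq (m ^ j * c0).-1 Jf1
  else [::].

Definition form_word (p : nat * seq nat) : seq jstate :=
  nseq p.1 Jf1 ++ tail_word 0 p.2.

Definition normal_forms (n : nat) : set (nat * seq nat) :=
  [set p | all (ltn 0) p.2 /\ p.1 + weight p.2 <= n].

Lemma size_tail_word j c :
  all (ltn 0) c -> size (tail_word j c) = m ^ j * weight c.
Proof.
elim: c j => [|c0 c IH] j /=; first by rewrite muln0.
move=> /andP[c0_gt0 pos_c]; rewrite size_cat /= size_nseq IH // prednK ?muln_gt0 ?pow_gt0 //.
by rewrite expnSr mulnDr mulnA addnC.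
Qed.

Lemma size_form_word p :
  all (ltn 0) p.2 -> size (form_word p) = p.1 + weight p.2.
Proof. by move=> pos; rewrite size_cat size_nseq size_tail_word // mul1n. Qed.

Lemma weight_rcons c d : weight (rcons c d) = weight c + m ^ size c * d.
Proof.
elim: c => [|c0 c IH] /=; first by rewrite muln0 mul1n addn0.
by rewrite IH expnS mulnDr addnA mulnA.
Qed.

Lemma tail_word_rcons j c d :
  tail_word j (rcons c d) =
  Jf0 :: nseq (m ^ (j + size c) * d).-1 Jf1 ++ tail_word j c.
Proof.
elim: c j => [|c0 c IH] j /=; first by rewrite addn0 cats0.
by rewrite IH addnS -addSn /= -catA.
Qed.

Lemma act_tail_word_cons j c0 c x :
  0 < c0 ->
  act (tail_word j (c0 :: c)) x
    = act (tail_word j.+1 c) (f0_nat (x + m ^ j * c0).-1).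
Proof.
move=> c0_gt0; rewrite /= act_cat /= act_nseq; congr (act _ (f0_nat _)).
by have := pow_gt0 j; nia.
Qed.

(** Adding 1 to a predecessor of a multiple of [m ^ j] carries through at least
    [j] digits, and [Jf0] clears one digit more. *)
Lemma dvdn_f0_nat j x : 0 < x -> m ^ j %| x -> m ^ j.+1 %| f0_nat x.-1.
Proof.
move=> x_gt0; have [v [y [r [r0 rm ->]]]] := carry_decomp _ m_gt1 _ x_gt0.
rewrite dvdn_carry // f0_natE // => le_jv.
by apply: dvdn_mulr; apply: dvdn_exp2l.
Qed.

Lemma dvdn_tail_word j c x :
  all (ltn 0) c -> m ^ j %| x -> m ^ (j + size c) %| act (tail_word j c) x.
Proof.
elim: c j x => [|c0 c IH] j x; first by rewrite addn0.
move=> /andP[/= c0_gt0 pos_c] dv_x.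
rewrite addnS -addSn act_tail_word_cons //; apply: IH => //.
by apply: dvdn_f0_nat; rewrite ?addn_gt0 ?muln_gt0 ?pow_gt0 ?c0_gt0 ?orbT // dvdn_addr ?dvdn_mulr.
Qed.

(** If the carry stops below position [k], then [Jf0] does not see the digits
    from [k] on. *)
Lemma f0_nat_add k x z :
  m ^ k %| z -> ~~ (m ^ k %| x.+1) -> f0_nat (x + z) = f0_nat x + z.
Proof.
move=> dv_z; have [v [y [r [r0 rm def_x]]]] := carry_decomp _ m_gt1 x.+1 isT.
rewrite def_x dvdn_carry // -ltnNge => lt_vk.
have /dvdnP[t def_z] := dvdn_trans (dvdn_exp2l m lt_vk) dv_z.
have -> : x = (m ^ v * (m * y + r)).-1 by rewrite -def_x.
have -> : (m ^ v * (m * y + r)).-1 + z = (m ^ v * (m * (y + t) + r)).-1.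
  by rewrite def_z expnS; have := pow_gt0 v; nia.
by rewrite !f0_natE // mulnDr def_z [t * _]mulnC.
Qed.

Lemma f0_nat_le x : f0_nat x <= x.
Proof. by rewrite /f0_nat mulnC leq_trunc_div. Qed.

(** [Jf0] never increases its argument. *)
Lemma act_le u x : act u x <= x + size u.
Proof.
elim: u => [|q u IH]; first by rewrite addn0.
by case: q => /=; rewrite ?addnS ?ltnS ?(leq_trans (f0_nat_le _)) ?(leq_trans IH) ?ltnS.
Qed.

(** A number below [m ^ k] that stays too small to carry into position [k] is
    transformed independently of the digits from [k] on. *)
Lemma act_add u k x z :
  m ^ k %| z -> x + size u < m ^ k -> act u (x + z) = act u x + z.
Proof.
move=> dv_z; elim: u => //= q u IH lt_k.
have le_u := act_le u x.
rewrite IH; last lia.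
case: q => //=.
apply: (f0_nat_add k) => //; apply/negP => /dvdn_leq; lia.
Qed.

(** Multiplying a normal form by [Jf0] on the left.  The tail of level
    [size c] only takes values divisible by [m ^ size c].  If this power divides
    [a + 1], the translation by [a] is the next exponent of the tail; otherwise
    the carry stops below position [size c], and [Jf0] after the translation by
    [a] is the translation by [f0_nat a <= a]. *)
Lemma form_word_surj u :
  exists2 p, normal_forms (size u) p & act u =1 act (form_word p).
Proof.
elim: u => [|q u [[a c] [/= pos_c le_u] eq_u]].
  by exists (0, [::]).
case: q => /=.
- by exists (a, c) => //=; split=> //=; lia.
- have eq_f0 x : act (Jf0 :: u) x = f0_nat (a + act (tail_word 0 c) x).
    by rewrite /= eq_u act_cat act_nseq.
  have [/dvdnP[d def_a]|ndv] := boolP (m ^ size c %| a.+1).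
    have d_gt0 : 0 < d by lia.
    exists (0, rcons c d); first split=> /=.
    + by rewrite all_rcons /= d_gt0.
    + by rewrite weight_rcons mulnC -def_a; lia.
    by move=> x; rewrite eq_f0 /form_word /= tail_word_rcons /= act_cat act_nseq add0n mulnC -def_a.
  exists (f0_nat a, c); first by split=> //=; have := f0_nat_le a; lia.
  move=> x; rewrite eq_f0 act_cat act_nseq.
  by apply: (f0_nat_add (size c)) => //; apply: (dvdn_tail_word 0) => //; rewrite dvd1n.
- exists (a.+1, c); first by split=> //=; rewrite addSn.
  by move=> x; rewrite /= eq_u /form_word !act_cat !act_nseq.
Qed.

Lemma f0_nat_pow K : f0_nat (m ^ K).-1 = 0.
Proof.
by have := f0_natE _ m_gt1 K 0 1 isT m_gt1; rewrite muln0 add0n !muln1 muln0.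
Qed.

(** At [m ^ K - m ^ j * c0] the first translation produces [m ^ K - 1], all of
    whose digits are cleared: the value does not depend on [K]. *)
Lemma act_cons_pole j c0 c K a :
  0 < c0 -> m ^ j * c0 <= m ^ K ->
  act (nseq a Jf1 ++ tail_word j (c0 :: c)) (m ^ K - m ^ j * c0)
    = act (nseq a Jf1 ++ tail_word j.+1 c) 0.
Proof.
move=> c0_gt0 le_K.
by rewrite !(act_cat m (nseq _ _)) act_tail_word_cons // subnK // f0_nat_pow.
Qed.

(** Closer to [m ^ K] than the argument of [act_cons_pole], the first translation
    passes [m ^ K], and the rest of the word acts below position [K] only. *)
Lemma act_cons_past_pole j c0 d c a K :
  0 < d -> d < c0 ->
  m ^ j * c0 + size (nseq a Jf1 ++ tail_word j.+1 c) < m ^ K ->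
  m ^ K <= act (nseq a Jf1 ++ tail_word j (c0 :: c)) (m ^ K - m ^ j * d).
Proof.
move=> d_gt0 lt_dc lt_K.
have pj := pow_gt0 j.
have le_dc : m ^ j * d < m ^ j * c0 by rewrite ltn_pmul2l.
rewrite (act_cat m (nseq _ _)) act_tail_word_cons 1?(ltn_trans d_gt0) //.
have -> : (m ^ K - m ^ j * d + m ^ j * c0).-1
            = (m ^ j * c0 - m ^ j * d).-1 + m ^ K by lia.
rewrite (f0_nat_add K) //; last first.
  by apply/negP => /dvdn_leq; lia.
rewrite -act_cat (act_add _ K) ?leq_addl //.
have := f0_nat_le (m ^ j * c0 - m ^ j * d).-1; lia.
Qed.

(** The head of [c] is the least [d > 0] for which the values at
    [m ^ K - m ^ j * d] are bounded as [K] grows; there is no such [d] when [c]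
    is empty.  Once the heads agree, the first translation followed by [Jf0]
    reaches all large multiples of [m ^ j.+1] from large multiples of [m ^ j], so
    the tails can be compared in turn.  Only large arguments remain available at each
    step, whence the bound [B]. *)
Lemma form_word_inj_large j B a a' c c' :
  all (ltn 0) c -> all (ltn 0) c' ->
  (forall x, m ^ j %| x -> B <= x ->
     act (nseq a Jf1 ++ tail_word j c) x
       = act (nseq a' Jf1 ++ tail_word j c') x) ->
  a = a' /\ c = c'.
Proof.
have ltK i n : exists2 K, i <= K & n < m ^ K.
  exists (i + n); first by apply: leq_addr.
  by apply: leq_ltn_trans (leq_addl i n) (ltn_expl _ m_gt1).
have not_nil i b b' B0 d0 d : 0 < d0 ->
  (forall x, m ^ i %| x -> B0 <= x ->
     act (nseq b Jf1 ++ tail_word i (d0 :: d)) x = b' + x) -> False.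
  move=> d0_gt0 eq_x.
  set V := act (nseq b Jf1 ++ tail_word i.+1 d) 0.
  have [K le_iK lt_K] := ltK i (B0 + m ^ i * d0 + V).
  have := eq_x (m ^ K - m ^ i * d0); rewrite act_cons_pole //; last by lia.
  suff dv : m ^ i %| m ^ K - m ^ i * d0 by move=> /(_ dv); rewrite -/V; lia.
  by rewrite dvdn_sub ?dvdn_mulr ?dvdn_exp2l.
have not_lt i b b' B0 d0 d d0' d' : 0 < d0 -> d0 < d0' ->
  (forall x, m ^ i %| x -> B0 <= x ->
     act (nseq b Jf1 ++ tail_word i (d0 :: d)) x
       = act (nseq b' Jf1 ++ tail_word i (d0' :: d')) x) -> False.
  move=> d0_gt0 lt_d eq_x.
  set V := act (nseq b Jf1 ++ tail_word i.+1 d) 0.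
  set S := size (nseq b' Jf1 ++ tail_word i.+1 d').
  have [K le_iK lt_K] := ltK i (B0 + m ^ i * d0' + V + S).
  have le_d : m ^ i * d0 <= m ^ i * d0' by rewrite leq_mul // ltnW.
  have := eq_x (m ^ K - m ^ i * d0); rewrite act_cons_pole //; last by lia.
  have dv : m ^ i %| m ^ K - m ^ i * d0.
    by rewrite dvdn_sub ?dvdn_mulr ?dvdn_exp2l.
  move=> /(_ dv); rewrite -/V => eqV.
  have := act_cons_past_pole i d0' d0 d' b' K d0_gt0 lt_d.
  by rewrite -/S -eqV; lia.
elim: c c' j B => [|c0 c IH] [|c0' c'] j B.
- move=> _ _ /(_ (m ^ j * B)); rewrite dvdn_mulr // leq_pmull // => /(_ isT isT).
  by rewrite !cats0 !act_nseq => /addIn.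
- move=> _ /andP[/= c0_gt0 _] eq_x; exfalso; apply: (not_nil j a' a B c0' c') => // x dv_x le_x.
  by rewrite -eq_x // cats0 act_nseq.
- move=> /andP[/= c0_gt0 _] _ eq_x; exfalso; apply: (not_nil j a a' B c0 c) => // x dv_x le_x.
  by rewrite eq_x // cats0 act_nseq.
move=> /andP[/= c0_gt0 pos_c] /andP[/= c0_gt0' pos_c'] eq_x.
have [lt_c|lt_c|eq_c] := ltngtP c0 c0'.
- by case: (not_lt j a a' B c0 c c0' c').
- by case: (not_lt j a' a B c0' c' c0 c) => // x dv_x le_x; rewrite eq_x.
rewrite -{c0' c0_gt0'}eq_c in eq_x *.
have [||z dv_z le_z|-> ->] // := IH c' j.+1 (B + m ^ j * c0).
have {dv_z} [y def_z] := dvdnP dv_z.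
have pj := pow_gt0 j.
(* After the translation this argument is the predecessor of
   [m ^ j * (m * y + 1)], which [Jf0] sends to [m ^ j.+1 * y]. *)
have := eq_x (m ^ j * (m * y + 1 - c0)).
have def_z' : z = m ^ j * (m * y) by rewrite def_z expnS; nia.
rewrite dvdn_mulr // => /(_ isT); rewrite !(act_cat m (nseq _ _)) !act_tail_word_cons // -!mulnDr.
have le_c0 : c0 <= m * y by rewrite -(leq_pmul2l pj); lia.
rewrite subnK ?f0_natE //; last by lia.
rewrite def_z [y * _]mulnC; apply.
by rewrite mulnBr mulnDr -def_z'; lia.
Qed.

Lemma form_word_inj p p' n n' :
  normal_forms n p -> normal_forms n' p' -> act (form_word p) =1 act (form_word p') -> p = p'.
Proof.
case: p p' => [a c] [a' c'] [/= pos_c _] [/= pos_c' _] eq_x.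
by have [|-> ->] := form_word_inj_large 0 0 a a' c c' pos_c pos_c'.
Qed.

End NormalForms.

(** * Cardinals of finite sets given by sequences *)

Lemma card_fset_set_seq (T : choiceType) (s : seq T) :
  #|` fset_set [set` s]| = size (undup s).
Proof.
rewrite -card_fseq -[in RHS](set_fsetK [fset x in s]%fset); congr #|` fset_set _|.
by apply/seteqP; split=> x /=; rewrite inE.
Qed.

Lemma card_fset_set_mono (T : choiceType) (S S' : set T) :
  finite_set S' -> S `<=` S' -> #|` fset_set S| <= #|` fset_set S'|.
Proof.
move=> finS' subS; apply: fsubset_leq_card.
by rewrite -fset_set_sub //; apply: sub_finite_set finS'.
Qed.

Lemma card_fset_set_le_size (T : choiceType) (S : set T) (s : seq T) :
  S `<=` [set` s] -> #|` fset_set S| <= size s.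
Proof.
move=> subS; apply: leq_trans (size_undup s).
by rewrite -card_fset_set_seq; apply: card_fset_set_mono.
Qed.

Lemma size_le_card_fset_set (T : choiceType) (S : set T) (s : seq T) :
  finite_set S -> uniq s -> [set` s] `<=` S -> size s <= #|` fset_set S|.
Proof.
move=> finS uniq_s subS; rewrite -{1}(undup_id uniq_s) -card_fset_set_seq.
exact: card_fset_set_mono.
Qed.

Lemma card_fset_set_inj (T U : choiceType) (f : T -> U) (S : set T) :
  finite_set S -> set_inj S f -> #|` fset_set (f @` S)| = #|` fset_set S|.
Proof.
move=> finS injf; rewrite fset_set_image // card_in_imfset // => x y.
rewrite !in_fset_set //; exact: injf.
Qed.

(** * Boxes of sequences *)

Fixpoint box (bs : seq nat) : seq (seq nat) :=
  if bs is b :: bs' then [seq x :: s | x <- iota 0 b, s <- box bs']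
  else [:: [::]].

Lemma size_box bs : size (box bs) = \prod_(b <- bs) b.
Proof.
elim: bs => [|b bs IH] /=; first by rewrite big_nil.
by rewrite size_allpairs size_iota IH big_cons.
Qed.

Lemma mem_box_cons b bs x s :
  (x :: s \in box (b :: bs)) = (x < b) && (s \in box bs).
Proof.
apply/allpairsP/andP => [[[y t] /= [y_lt t_in [-> ->]]]|[x_lt s_in]].
  by move: y_lt; rewrite mem_iota.
by exists (x, s); split; rewrite // mem_iota.
Qed.

Lemma uniq_box bs : uniq (box bs).
Proof.
elim: bs => //= b bs IH; apply: allpairs_uniq => //; first exact: iota_uniq.
by move=> [x s] [y t] _ _ /= [-> ->].
Qed.

Lemma box_consP b bs s :
  s \in box (b :: bs) -> exists x t, [/\ s = x :: t, x < b & t \in box bs].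
Proof.
move=> /allpairsP[[x t] /= [x_in t_in ->]]; exists x, t; split=> //.
by move: x_in; rewrite mem_iota.
Qed.

(** * Counting the normal forms of J_m *)

Lemma sum_subn_iota n : 2 * \sum_(0 <= a < n) (n - a) = n * n.+1.
Proof.
elim: n => [|n IH]; first by rewrite big_geq.
rewrite big_nat_recl // mulnDr subn0; under eq_bigr do rewrite subSS.
by rewrite IH; lia.
Qed.

(** The number of entries of [c] is not fixed, so [c] is padded with zeros to the
    length [d]; as the entries of [c] are positive, erasing the zeros recovers
    it.  The exponents [e j] measure the powers of [M] by powers of [m]. *)
Lemma mem_box_weight m M (e : nat -> nat) L d i c :
  1 < m -> (forall j, j <= e j) -> (forall j, m ^ e j <= M ^ j) ->
  L = i + d -> all (ltn 0) c -> M ^ i * weight M c < m ^ L ->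
  exists2 s, s \in box [seq m ^ (L - e j) | j <- iota i d]
           & [seq x <- s | 0 < x] = c.
Proof.
move=> m_gt1 le_e le_M; have pm k : 0 < m ^ k by rewrite expn_gt0 ltnW.
elim: d i c => [|d IH] i c def_L.
  case: c => [|c0 c] /=; first by exists [::].
  rewrite def_L addn0 => /andP[c0_gt0 _] lt_L.
  have := leq_trans (leq_pexp2l (ltnW m_gt1) (le_e i)) (le_M i); nia.
have {}IH := IH i.+1 _ (etrans def_L (addnS _ _)).
case: c => [|c0 c] /=.
  move=> _ _; have [|s s_in filt_s] := IH [::] isT; first by rewrite muln0 pm.
  by exists (0 :: s) => //; rewrite mem_box_cons s_in pm.
move=> /andP[c0_gt0 pos_c] lt_L.
have [||s s_in filt_s] := IH c; [done|by rewrite expnSr; nia|].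
exists (c0 :: s); last by rewrite /= c0_gt0 filt_s.
rewrite mem_box_cons s_in andbT.
have lt_L' : m ^ e i * c0 < m ^ L by have := le_M i; nia.
have [le_eL|lt_Le] := leqP (e i) L.
  by move: lt_L'; rewrite -{1}(subnKC le_eL) expnD ltn_pmul2l.
have := leq_pexp2l (ltnW m_gt1) (ltnW lt_Le); nia.
Qed.

Lemma normal_forms_sub_box m M (e : nat -> nat) L n :
  1 < m -> (forall j, j <= e j) -> (forall j, m ^ e j <= M ^ j) ->
  n < m ^ L ->
  normal_forms M n `<=`
    [set` [seq (head 0 s, [seq x <- behead s | 0 < x])
          | s <- box (m ^ L :: [seq m ^ (L - e j) | j <- iota 0 L])]].
Proof.
move=> m_gt1 le_e le_M lt_n [a c] [/= pos_c le_n].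
have [|s s_in filt_s] := mem_box_weight _ _ e L L 0 c m_gt1 le_e le_M erefl pos_c.
  by rewrite expn0 mul1n; lia.
apply/mapP; exists (a :: s); last by rewrite /= filt_s.
rewrite mem_box_cons s_in andbT; lia.
Qed.

Lemma finite_normal_forms m n : 1 < m -> finite_set (normal_forms m n).
Proof.
move=> m_gt1; apply: sub_finite_set (finite_seq _).
by apply: (normal_forms_sub_box m m id n) => //; apply: ltn_expl.
Qed.

Lemma card_normal_forms_le m M (e : nat -> nat) L n :
  1 < m -> (forall j, j <= e j) -> (forall j, m ^ e j <= M ^ j) ->
  n < m ^ L ->
  #|` fset_set (normal_forms M n)| <= m ^ (L + \sum_(0 <= j < L) (L - e j)).
Proof.
move=> m_gt1 le_e le_M lt_n.
apply: leq_trans (card_fset_set_le_size _ _ _ (normal_forms_sub_box _ _ _ _ _ m_gt1 le_e le_M lt_n)) _.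
by rewrite size_map size_box big_cons big_map expnD expn_sum /index_iota subn0.
Qed.

(** Each of the [d] terms of the weight is at most [m ^ (i + d)].  The successor
    turns the entries of a box into positive ones. *)
Lemma weight_box m d i s :
  s \in box [seq m ^ (i + d - j) | j <- iota i d] ->
  m ^ i * weight m (map succn s) <= d * m ^ (i + d).
Proof.
elim: d i s => [|d IH] i s; first by rewrite inE => /eqP->; rewrite muln0.
move=> /box_consP[x [t [-> x_lt t_in]]] /=.
rewrite mulnDr mulSn leq_add //.
  apply: leq_trans (_ : m ^ i * m ^ (i + d.+1 - i) <= _); first by rewrite leq_mul.
  by rewrite -expnD subnKC // leq_addr.
by rewrite mulnA -expnSr addnS -addSn IH // addSn -addnS.
Qed.

Lemma card_normal_forms_ge m k :
  1 < m ->
  m ^ (\sum_(0 <= j < k) (k - j)) <= #|` fset_set (normal_forms m (k * m ^ k))|.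
Proof.
move=> m_gt1.
pose B := [seq (0, map succn s) | s <- box [seq m ^ (k - j) | j <- iota 0 k]].
have -> : m ^ (\sum_(0 <= j < k) (k - j)) = size B.
  by rewrite size_map size_box big_map expn_sum /index_iota subn0.
apply: size_le_card_fset_set; first exact: finite_normal_forms.
  by rewrite map_inj_uniq ?uniq_box // => s t [] /(inj_map succn_inj).
move=> _ /mapP[s s_in ->]; split=> /=; first by rewrite all_map; apply/allP.
by have := weight_box m k 0 s s_in; rewrite mul1n.
Qed.

(** When [n < m] a second entry in [c] would already weigh more than [n], so that
    [c] is empty or a singleton.  Reading an empty [c] as the entry 0, one counts
    the pairs [(a, b)] with [a + b <= n]. *)
Lemma card_normal_forms_small m n : n < m ->
  #|` fset_set (normal_forms m n)| = ((n + 1) * (n + 2)) %/ 2.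
Proof.
move=> lt_nm.
pose s := [seq (a, [seq x <- [:: b] | 0 < x]) | a <- iota 0 n.+1, b <- iota 0 (n.+1 - a)].
have -> : normal_forms m n = [set` s].
  apply/seteqP; split=> [[a c] [/= pos_c le_n]|p].
    apply/allpairsPdep; exists a, (weight m c); rewrite !mem_iota /=.
    case: c pos_c le_n => [|c0 [|c1 c]] /=; rewrite ?muln0 ?addn0.
    - by split=> //; lia.
    - by rewrite andbT => c0_gt0 le_n; rewrite c0_gt0; split=> //; lia.
    - by move=> /and3P[c0_gt0 c1_gt0 _]; nia.
  move=> /allpairsPdep[a [b [a_in b_in ->]]].
  move: a_in b_in; rewrite !mem_iota /= => a_lt b_lt.
  by case: b b_lt => [|b] b_lt; split=> //=; lia.
rewrite card_fset_set_seq undup_id; last first.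
  apply: allpairs_uniq_dep => [||[a b] [a' b'] /=]; first exact: iota_uniq.
    by move=> a _; apply: iota_uniq.
  by move=> _ _ [-> ]; case: b b' => [|b] [|b'] //= [->].
rewrite size_allpairs_dep.
under eq_map do rewrite size_iota.
rewrite sumnE big_map -[iota _ _]/(index_iota 0 n.+1).
by have := sum_subn_iota n.+1; lia.
Qed.

Lemma transf_J_Je m w : transf (J m) Je w = w.
Proof. by apply: transf_identity => x //=; rewrite if_same. Qed.

Lemma growth_J m n : 1 < m -> growth (J m) n = #|` fset_set (normal_forms m n)|.
Proof.
move=> m_gt1; have finS := finite_normal_forms m n m_gt1.
rewrite -(card_fset_set_inj _ _ (fun p => product (J m) (form_word m p)) (normal_forms m n)) //; last first.
  move=> p p' /set_mem Sp /set_mem Sp' /(product_eqP _ m_gt1).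
  exact: form_word_inj Sp Sp'.
congr #|` fset_set _|; apply/seteqP; split=> [_ [u <- <-]|_ [p [pos_p le_p] <-]].
  have [p Sp eq_p] := form_word_surj m m_gt1 u.
  by exists p => //; apply/esym/(product_eqP _ m_gt1).
exists (nseq (n - (p.1 + weight m p.2)) Je ++ form_word m p).
  by rewrite /= size_cat size_nseq size_form_word // subnK.
by rewrite product_cat product_nseq_id //; apply: transf_J_Je.
Qed.

(** * Comparison of the growth orders of J_m and J_{m+1} *)

Lemma double_expn_succ m : 0 < m -> 2 * m ^ m <= m.+1 ^ m.
Proof.
case: m => // m _.
have bernoulli n x : x ^ n.+1 + n.+1 * x ^ n <= x.+1 ^ n.+1.
  elim: n => [|n IH]; first by rewrite !expn1 expn0; lia.
  rewrite [x.+1 ^ _]expnS; move: IH; rewrite [x ^ n.+2]expnS [x ^ n.+1]expnS.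
  set y := x ^ n; set z := x.+1 ^ _; nia.
by have := bernoulli m m.+1; rewrite [in X in _ + X]mulnC -expnSr mul2n addnn.
Qed.

Lemma expn_succ_gain m : 1 < m -> m ^ (m * m).+1 <= m.+1 ^ (m * m).
Proof.
move=> m_gt1; have m_gt0 := ltnW m_gt1.
(* [m ^ (m * m).+1 = m * (m ^ m) ^ m] and [m <= 2 ^ m]. *)
apply: leq_trans (_ : (2 * m ^ m) ^ m <= _).
  rewrite expnMn -expnM expnS leq_mul //.
  exact/ltnW/ltn_expl.
by rewrite [X in _ <= X]expnM leq_exp2r // double_expn_succ.
Qed.

(** The gain of one factor [m] for every [m * m] factors [m + 1] comes from
    [(m + 1)^m >= 2 m^m], raised to the power [m], and [2^m >= m]. *)
Lemma expn_gain m j : 1 < m -> m ^ (j + j %/ (m * m)) <= m.+1 ^ j.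
Proof.
move=> m_gt1; set q := m * m.
have -> : j + j %/ q = q.+1 * (j %/ q) + j %% q.
  by rewrite {1}(divn_eq j q); lia.
rewrite [in X in _ <= X](divn_eq j q) [j %/ q * q]mulnC expnD [X in _ <= X]expnD (expnM m q.+1) (expnM m.+1 q) leq_mul //.
  have [->|d_gt0] := posnP (j %/ q); first by rewrite !expn0.
  by rewrite leq_exp2r // expn_succ_gain.
have [->|d_gt0] := posnP (j %% q); first by rewrite !expn0.
by rewrite leq_exp2r.
Qed.

(** The saving [j %/ q] is at least [r] for the [r] indices starting at [q * r],
    and truncated subtraction does not lose it there, because these indices are
    at distance at least [r] from the upper bound. *)
Lemma sum_savings q r : 0 < q ->
  \sum_(0 <= j < q * r + r + r) (q * r + r + r - (j + j %/ q)) + r * r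
    <= \sum_(0 <= j < q * r + r + r) (q * r + r + r - j).
Proof.
move=> q_gt0; set L := q * r + r + r.
have -> : r * r = \sum_(0 <= j < L) (if q * r <= j < q * r + r then r else 0).
  transitivity (\sum_(q * r <= j < q * r + r) r).
    by rewrite sum_nat_const_nat; congr muln; lia.
  rewrite (big_nat_widen _ _ L) ?leq_addr // (big_nat_widenl _ 0) // big_mkcond /=.
  by apply: eq_bigr => j _; rewrite andbC.
rewrite -big_split /= !big_nat; apply: leq_sum => j /andP[_ lt_jL].
case: ifP => [/andP[le_j lt_j]|_]; last by rewrite addn0 leq_sub2l ?leq_addr.
have : r <= j %/ q by rewrite leq_divRL // mulnC.
by rewrite /L in lt_jL *; lia.
Qed.

Lemma sum_subn_shift k s :
  \sum_(0 <= j < k + s) (k + s - j) <= \sum_(0 <= j < k) (k - j) + (k + s) * s.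
Proof.
have -> : \sum_(0 <= j < k) (k - j) = \sum_(0 <= j < k + s) (k - j).
  rewrite [RHS](big_cat_nat (n := k)) ?leq_addr //= [X in _ = _ + X]big_nat_cond.
  by rewrite [X in _ = _ + X]big1 ?addn0 // => j /andP[/andP[]]; lia.
have -> : (k + s) * s = \sum_(0 <= j < k + s) s by rewrite sum_nat_const_nat subn0.
by rewrite -big_split /=; apply: leq_sum => j _; lia.
Qed.

Lemma linear_lt_expn a b : exists s, a + b * s < 2 ^ s.
Proof.
pose t := (a + 2 * b).+1; exists (2 * t).
have := ltn_expl t (isT : 1 < 2); rewrite mul2n -addnn expnD.
rewrite /t; nia.
Qed.

(** The arguments [k * m ^ k] refute the comparison.  Dilating by [C2] leads to
    numbers below [m ^ L], where [L = k + s] and [C2 * L < 2 ^ s]; this shift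
    costs [L * s] in the exponent.  The saving in base [m + 1] is [r * r] with
    [L = (q + 2) * r], and [r] is taken just large enough, as an affine function
    of [s], for the saving to outweigh the cost. *)
Lemma growth_J_not_le m : 1 < m -> ~ growth_le (growth (J m)) (growth (J m.+1)).
Proof.
move=> m_gt1 [C1 [C2 [N0 le_growth]]]; have m_gt0 := ltnW m_gt1.
pose q := m * m.
have q_gt0 : 0 < q by rewrite muln_gt0 m_gt0.
(* The size [L = (q + 2) r] must satisfy [C1 + L + L s <= r r], where [C1] bounds the
   exponent of the factor [C1 < m ^ C1]; the term [N0] makes [k] large enough. *)
pose r_ s := N0 + C1 + (q + 2) * s.+1.
(* As [L] is affine in [s], some [s] satisfies [C2 * L < 2 ^ s]. *)
have [s lt_s] := linear_lt_expn (C2 * (q + 2) * (N0 + C1 + (q + 2))) (C2 * (q + 2) * (q + 2)).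
pose r := r_ s; pose L := q * r + r + r.
have def_L : L = (q + 2) * r by rewrite /L; lia.
have le_rL : 2 * r <= L by rewrite /L; lia.
have le_sr : s + N0 <= r by rewrite /r /r_; nia.
pose k := L - s.
have def_k : k + s = L by rewrite subnK //; lia.
have lt_L : C2 * (k * m ^ k) < m ^ L.
  have lt_2s : C2 * k < 2 ^ s.
    apply: leq_ltn_trans lt_s.
    have -> : C2 * (q + 2) * (N0 + C1 + (q + 2)) + C2 * (q + 2) * (q + 2) * s = C2 * L.
      by rewrite def_L /r /r_; lia.
    by rewrite leq_mul // /k leq_subr.
  have le_2m : 2 ^ s <= m ^ s by case: (posnP s) => [->//|s_gt0]; rewrite leq_exp2r.
  by rewrite -def_k expnD mulnA mulnC ltn_pmul2l ?expn_gt0 ?m_gt0 // (leq_trans lt_2s).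
have pk : k <= k * m ^ k by rewrite leq_pmulr // expn_gt0 m_gt0.
have := le_growth (k * m ^ k); rewrite !growth_J //.
have -> : N0 <= k * m ^ k by apply: leq_trans pk; rewrite /k; lia.
move=> /(_ isT); apply/negP; rewrite -ltnNge.
pose e j := j + j %/ q.
have := card_normal_forms_le m m.+1 e L (C2 * (k * m ^ k)) m_gt1 _ _ lt_L.
move=> /(_ (fun j => leq_addr _ _) (fun j => expn_gain m j m_gt1)) upper.
apply: leq_trans (card_normal_forms_ge m k m_gt1).
apply: leq_ltn_trans (leq_mul (leqnn C1) upper) _.
apply: leq_trans (_ : m ^ C1 * m ^ (L + \sum_(0 <= j < L) (L - e j)) <= _).
  by rewrite ltn_pmul2r ?expn_gt0 ?m_gt0 // ltn_expl.
rewrite -expnD leq_exp2l //.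
have := sum_savings q r q_gt0; rewrite -/L => savings.
have := sum_subn_shift k s; rewrite def_k => shift.
have : C1 + L + L * s <= r * r.
  rewrite def_L /r /r_; nia.
rewrite /e; lia.
Qed.

Lemma growth_J_lt m : 1 < m -> growth_lt (growth (J m.+1)) (growth (J m)).
Proof.
move=> m_gt1; split; last by case=> _ /(growth_J_not_le _ m_gt1).
exists 1, 1, 0 => n _; rewrite !mul1n !growth_J //; last by apply: ltnW.
apply: card_fset_set_mono; first exact: finite_normal_forms.
move=> [a c] [/= pos_c le_n]; split=> //=; apply: leq_trans le_n.
rewrite leq_add2l; elim: c {pos_c} => //= c0 c IH.
by rewrite leq_add2l; nia.
Qed.

(** * Presentations, monoid growth and similarity *)

Section Presentations.
Variables (X Q : Type) (A : mealy X Q) (R : seq Q -> seq Q -> Prop).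

Lemma congr_product u v :
  (forall u' v', R u' v' -> product A u' = product A v') ->
  congr R u v -> product A u = product A v.
Proof.
move=> sound; elim=> {u v}.
- exact: sound.
- by [].
- by move=> u v _ ->.
- by move=> u v w _ -> _ ->.
- by move=> u u' v v' _ eq_u _ eq_v; rewrite !product_cat eq_u eq_v.
Qed.

(** The isomorphism evaluates any representative of a congruence class. *)
Lemma has_presentation_of_congr :
  (forall u v, congr R u v <-> product A u = product A v) ->
  has_presentation A R.
Proof.
move=> congrE.
pose phi (C : set (seq Q)) :=
  if pselect (exists u, C u) is left h then product A (projT1 (cid h)) else id.
have phiE u : phi (congr_class R u) = product A u.
  rewrite /phi; case: pselect => [h|[]]; last by exists u; apply: congr_refl.
  by case: (cid h) => v /= /congrE.
exists phi; split.
- split=> [_ [u _ <-]|_ _ /set_mem[u _ <-] /set_mem[v _ <-]|_ [u _ <-]].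
  + by rewrite phiE; exists u.
  + rewrite !phiE => /congrE uv; apply/seteqP; split=> t; apply: congr_trans => //.
    exact: congr_sym.
  + by exists (congr_class R u); rewrite ?phiE //; exists u.
- by rewrite phiE.
- by move=> u v; rewrite !phiE product_cat.
- by move=> q; rewrite phiE.
Qed.

End Presentations.

(** With an identity state among the generators, a transformation has length at
    most [n] exactly when it is a product of [n] states. *)
Lemma monoid_growthE (X : choiceType) (Q : Type) (A : mealy X Q) (q : Q) n :
  (forall w, transf A q w = w) -> monoid_growth A n = growth A n.
Proof.
move=> idq; congr #|` fset_set _|; apply/seteqP; split=> [s [[u _ eq_u]]|s].
  rewrite /length_in; case: pselect => [h|[]]; last first.
    by exists (size u); apply/asboolP; exists u.
  case: ex_minnP => k /asboolP[v <- <-] _ le_kn.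
  exists (nseq (n - size v) q ++ v); first by rewrite /= size_cat size_nseq subnK.
  by rewrite product_cat product_nseq_id.
move=> s_n; split; first by case: s_n => u _ <-; exists u.
rewrite /length_in; case: pselect => // h.
by case: ex_minnP => k _; apply; apply/asboolP.
Qed.

Section Similarity.
Variables (X1 X2 : choiceType) (Q1 Q2 : Type).
Variables (A1 : mealy X1 Q1) (A2 : mealy X2 Q2).
Variables (xi : X1 -> X2) (theta : Q1 -> Q2).
Hypothesis trans_xi :
  forall x q, theta (trans A1 x q) = trans A2 (xi x) (theta q).
Hypothesis out_xi : forall x q, xi (out A1 x q) = out A2 (xi x) (theta q).

Lemma product_similar u w :
  product A2 (map theta u) (xi \o w) = xi \o product A1 u w.
Proof.
have stateE q w' n : state_at A2 (theta q) (xi \o w') n = theta (state_at A1 q w' n).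
  by elim: n => //= n ->; rewrite trans_xi.
elim: u => //= q u ->; apply: funext => n.
by rewrite /transf stateE /= out_xi.
Qed.

End Similarity.

Lemma growth_similar (X1 X2 : choiceType) (Q1 Q2 : Type)
    (A1 : mealy X1 Q1) (A2 : mealy X2 Q2) n :
  similar A1 A2 -> finite_set (products A1 n) -> growth A2 n = growth A1 n.
Proof.
move=> [xi [theta [[xi' xiK xi'K] [theta' _ theta'K] trans_xi out_xi]]] fin.
pose conj (s : (nat -> X1) -> nat -> X1) (w : nat -> X2) := xi \o s (xi' \o w).
have conjE u : conj (product A1 u) = product A2 (map theta u).
  apply: funext => w; rewrite /conj -(product_similar _ _ _ _ _ _ _ _ trans_xi out_xi).
  by congr product; apply: funext => i /=; rewrite xi'K.
rewrite /growth -(card_fset_set_inj _ _ conj) //; last first.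
  move=> s t _ _ eq_st; apply: funext => w; apply: funext => i; apply: (can_inj xiK).
  have := congr1 (fun f => f (xi \o w) i) eq_st; rewrite /conj /=.
  by have -> : xi' \o (xi \o w) = w by apply: funext => k /=; rewrite xiK.
congr #|` fset_set _|; apply/seteqP; split=> [_ [v <- <-]|_ [_ [u <- <-] <-]].
  exists (product A1 (map theta' v)); first by exists (map theta' v); rewrite //= size_map.
  by rewrite conjE mapK.
by exists (map theta u); rewrite ?conjE //= size_map.
Qed.

(** * The monoid of J' *)

Definition set_head {X : Type} (y : X) (w : nat -> X) : nat -> X :=
  fun n => if n is 0 then y else w n.

Lemma set_head_idem (X : Type) (y z : X) w :
  set_head y (set_head z w) = set_head y w.
Proof. by apply: funext => -[]. Qed.

Local Notation jprod := (product Jprime).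

Lemma transf_Jprime_Je w : transf Jprime Je w = w.
Proof. by apply: transf_identity => [[]|]. Qed.

(** Away from the letter [None] only the first letter is read before the automaton
    falls into its identity state. *)
Lemma transf_Jprime_Some q w i : w 0 = Some i ->
  transf Jprime q w = set_head (out Jprime (Some i) q) w.
Proof.
move=> w0; apply: funext => -[|n]; first by rewrite transf0 w0.
by rewrite transfS w0 -[trans _ _ _]/Je transf_Jprime_Je.
Qed.

Lemma head_f0 w : transf Jprime Jf0 w 0 = Some 0.
Proof. by rewrite transf0; case: (w 0). Qed.

Lemma head_f1 w : exists i, transf Jprime Jf1 w 0 = Some i.
Proof. by rewrite transf0; case: (w 0) => [i|]; [exists i.+1|exists 0]. Qed.

Lemma jprod_pow_f1 p w i : w 0 = Some i ->
  jprod (nseq p Jf1) w = set_head (Some (p + i)) w.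
Proof.
move=> w0; elim: p => [|p IH] /=.
  by apply: funext => -[|n] //=; rewrite w0.
by rewrite IH (transf_Jprime_Some _ _ (p + i)) // set_head_idem.
Qed.

Lemma jprod_f0_pow_f1 p w i : w 0 = Some i ->
  jprod (Jf0 :: nseq p Jf1) w = set_head (Some 0) w.
Proof.
move=> w0 /=; rewrite (jprod_pow_f1 p w i w0).
by rewrite (transf_Jprime_Some _ _ (p + i)) // set_head_idem.
Qed.

Lemma jprod_rel u v : Jprime_rel u v -> jprod u = jprod v.
Proof.
case=> [|p|[//|p] _]; apply: funext => w.
- by rewrite /= transf_Jprime_Je.
- rewrite -cat_cons product_cat /=.
  have := jprod_f0_pow_f1 p _ 0 (head_f0 w); rewrite /= => ->.
  by apply: funext => -[|n] //=; rewrite head_f0.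
have [i w0] := head_f1 w.
have -> : Jf0 :: nseq p.+1 Jf1 = (Jf0 :: nseq p Jf1) ++ [:: Jf1].
  by rewrite -addn1 nseqD.
rewrite product_cat; have /= -> := jprod_f0_pow_f1 p _ _ w0.
by have /= -> := jprod_f0_pow_f1 0 _ _ w0.
Qed.

(** The normal forms [f1^p], [f1^p f0] and [f1^p f0 f1], coded by [(p, 0)],
    [(p, 1)] and [(p, 2)], so that the length is the sum of the two entries. *)
Definition Jprime_form_word (p : nat * nat) : seq jstate :=
  nseq p.1 Jf1 ++ take p.2 [:: Jf0; Jf1].

Definition Jprime_forms (n : nat) : set (nat * nat) :=
  [set p | p.2 <= 2 /\ p.1 + p.2 <= n].

Lemma size_Jprime_form_word p : p.2 <= 2 -> size (Jprime_form_word p) = p.1 + p.2.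
Proof. by move=> le2; rewrite size_cat size_nseq size_takel. Qed.

Lemma congr_cons q u v :
  congr Jprime_rel u v -> congr Jprime_rel (q :: u) (q :: v).
Proof. by move=> uv; apply: (congr_cat (congr_refl _ [:: q])). Qed.

(** Multiplying a normal form by [Jf0] on the left absorbs the power of [Jf1] by
    the relations, and leaves [f0] or [f0 f1]. *)
Lemma Jprime_form_word_surj u :
  exists2 p, Jprime_forms (size u) p & congr Jprime_rel u (Jprime_form_word p).
Proof.
elim: u => [|q u [[p k] [/= le_k2 le_u] eq_u]].
  by exists (0, 0) => //; apply: congr_refl.
have {}eq_u := congr_cons q _ _ eq_u.
case: q eq_u => eq_u.
- exists (p, k); first by split=> //=; lia.
  apply: congr_trans eq_u _; apply: (@congr_cat _ _ [:: Je] [::]); last exact: congr_refl.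
  by apply: congr_base; apply: Defs.rel_unit.
- have {le_k2} : k = 0 \/ k = 1 \/ k = 2 by lia.
  move=> [|[|]] def_k; rewrite {k}def_k in le_u eq_u.
  + case: p le_u eq_u => [|p] le_u eq_u; first by exists (0, 1).
    exists (0, 2); first by split=> //=; lia.
    apply: congr_trans eq_u _; rewrite /Jprime_form_word cats0.
    by apply: congr_base; apply: rel_power.
  + exists (0, 1); first by split=> //=; lia.
    by apply: congr_trans eq_u _; apply: congr_base; apply: rel_absorb.
  + exists (0, 2); first by split=> //=; lia.
    apply: congr_trans eq_u _.
    have -> : Jf0 :: Jprime_form_word (p, 2) = (Jf0 :: nseq p Jf1 ++ [:: Jf0]) ++ [:: Jf1].
      by rewrite /Jprime_form_word /= -catA.
    apply: (@congr_cat _ _ _ [:: Jf0]); last exact: congr_refl.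
    by apply: congr_base; apply: rel_absorb.
- exists (p.+1, k); first by split=> //=; lia.
  exact: eq_u.
Qed.

(** The constant word [x_0] shows the exponent of [f1]; the constant word [x_1]
    shows whether [f0] occurs, since [f0] resets the first letter; the word
    [x_(-1) x_0 x_0 ...] separates [f0] from [f0 f1], because [f1] carries into
    the second letter and [f0] does not change it afterwards. *)
Lemma Jprime_form_word_inj n n' p p' :
  Jprime_forms n p -> Jprime_forms n' p' -> jprod (Jprime_form_word p) = jprod (Jprime_form_word p') -> p = p'.
Proof.
case: p p' => [a k] [a' k'] [/= le_k _] [/= le_k' _] eq_p.
have eval b j w i : j <= 2 -> jprod (take j [:: Jf0; Jf1]) w 0 = Some i ->
    jprod (Jprime_form_word (b, j)) w
      = set_head (Some (b + i)) (jprod (take j [:: Jf0; Jf1]) w).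
  by move=> le_j w0; rewrite product_cat /= (jprod_pow_f1 _ _ i).
have suffix_cst j c : j <= 2 ->
    jprod (take j [:: Jf0; Jf1]) (fun=> Some c) 0 = Some (if j == 0 then c else 0).
  by case: j => [|[|[|]]].
have suffix_None j : j <= 2 ->
    let w n := if n is 0 then None else Some 0 in
    [/\ 0 < j -> jprod (take j [:: Jf0; Jf1]) w 0 = Some 0 &
        0 < j -> jprod (take j [:: Jf0; Jf1]) w 1 = Some j.-1].
  by case: j => [|[|[|]]].
have eq_a : a = a'.
  have := congr1 (fun s => s (fun=> Some 0) 0) eq_p.
  rewrite (eval _ _ _ 0) ?(eval _ _ _ 0) ?suffix_cst ?if_same //=.
  by rewrite !addn0 => -[].
rewrite -{a'}eq_a in eq_p *; congr pair.
have eq_k0 : (k == 0) = (k' == 0).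
  have := congr1 (fun s => s (fun=> Some 1) 0) eq_p.
  rewrite !(eval _ _ _ _ _ (suffix_cst _ _ _)) //= => -[].
  by case: (k == 0); case: (k' == 0) => //; lia.
have [k0|k_gt0] := posnP k; first by move: eq_k0; rewrite k0 eqxx => /esym/eqP.
have k'_gt0 : 0 < k' by rewrite lt0n -eq_k0 -lt0n.
have [h0 h1] := suffix_None k le_k; have [h0' h1'] := suffix_None k' le_k'.
have := congr1 (fun s => s (fun n => if n is 0 then None else Some 0) 1) eq_p.
by rewrite (eval _ _ _ 0) ?h0 // (eval _ _ _ 0) ?h0' //= h1 // h1' // => -[]; lia.
Qed.

Lemma congr_JprimeP u v :
  congr Jprime_rel u v <-> jprod u = jprod v.
Proof.
split=> [|eq_uv]; first by apply: congr_product; apply: jprod_rel.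
have [p Sp congr_u] := Jprime_form_word_surj u; have [p' Sp' congr_v] := Jprime_form_word_surj v.
have sound := fun s t => congr_product _ _ Jprime _ s t jprod_rel.
have eq_p : p = p'.
  by apply: Jprime_form_word_inj Sp Sp' _; rewrite -(sound _ _ congr_u) -(sound _ _ congr_v).
by rewrite -eq_p in congr_v; apply: congr_trans congr_u (congr_sym congr_v).
Qed.

Lemma products_Jprime n : products Jprime n = (jprod \o Jprime_form_word) @` Jprime_forms n.
Proof.
apply/seteqP; split=> [_ [u <- <-]|_ [p [le_k le_n] <-]].
  have [p Sp congr_u] := Jprime_form_word_surj u; exists p => //=.
  by apply/esym/congr_JprimeP.
exists (nseq (n - (p.1 + p.2)) Je ++ Jprime_form_word p).
  by rewrite /= size_cat size_nseq size_Jprime_form_word // subnK.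
by rewrite product_cat product_nseq_id //; apply: transf_Jprime_Je.
Qed.

Lemma Jprime_formsE n :
  Jprime_forms n = [set` [seq (p, k) | k <- iota 0 3, p <- iota 0 (n.+1 - k)]].
Proof.
apply/seteqP; split=> [[p k] [le_k le_n]|q].
  rewrite /= in le_k le_n.
  by apply/allpairsPdep; exists k, p; rewrite !mem_iota /=; split=> //; lia.
move=> /allpairsPdep[k [p [k_in p_in ->]]].
by move: k_in p_in; rewrite !mem_iota => k_lt p_lt; split=> /=; lia.
Qed.

Lemma finite_products_Jprime n : finite_set (products Jprime n).
Proof. by rewrite products_Jprime Jprime_formsE; apply: finite_image. Qed.

Lemma growth_Jprime n : 1 <= n -> growth Jprime n = 3 * n.
Proof.
move=> n_gt0; rewrite /growth products_Jprime card_fset_set_inj; last first.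
- by move=> p p' /set_mem Sp /set_mem Sp'; apply: Jprime_form_word_inj Sp Sp'.
- by rewrite Jprime_formsE; apply: finite_seq.
rewrite Jprime_formsE card_fset_set_seq undup_id; last first.
  apply: allpairs_uniq_dep => [||[k p] [k' p'] _ _ /= [-> ->]] //.
  by move=> k _; apply: iota_uniq.
by rewrite size_allpairs_dep /= !size_iota; lia.
Qed.

(** * Limits of automata and of growth functions *)

(** [Jprime] with its letters renumbered from 0, so that [Jf1] becomes the
    successor on all letters. *)
Definition Jlim : mealy nat jstate := {|
  trans x q := if x is 0 then q else Je;
  out x q := match q with Je => x | Jf0 => 1 | Jf1 => x.+1 end
|}.

Lemma similar_Jprime_Jlim : similar Jprime Jlim.
Proof.
exists (fun x => if x is Some i then i.+1 else 0), id; split.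
- by exists (fun i => if i is k.+1 then Some k else None) => -[].
- by exists id.
- by move=> [i|] [].
- by move=> [i|] [].
Qed.

(** [J m] conjugated by the cyclic successor of letters: the carrying letter is
    now 0 for every [m], and the table stabilizes as [m] grows. *)
Definition Jshift (m : nat) : mealy 'I_m jstate := {|
  trans (x : 'I_m) q := if val x == 0 then q else Je;
  out (x : 'I_m) q := match q with
             | Je => x
             | Jf0 => ordS (ord_zero x)
             | Jf1 => ordS x
             end
|}.

Lemma similar_J_Jshift m : 1 < m -> similar (J m) (Jshift m).
Proof.
move=> m_gt1; exists (@ordS m), id; split.
- exact: ordS_bij.
- by exists id.
- move=> x q /=; have := ltn_ord x; rewrite leq_eqVlt => /orP[/eqP eq_m|lt_m].
    by rewrite eq_m eqxx modnn.
  by rewrite modn_small // ltn_eqF.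
- move=> x [] //=; congr ordS; exact: val_inj.
Qed.

Lemma pointwise_limit_Jlim : pointwise_limit J Jlim.
Proof.
exists Jshift; split=> [m|i q]; first exact: similar_J_Jshift.
exists i.+2 => // m /= lt_im.
have lt_i : i < m by apply: ltnW.
exists (Ordinal lt_i); split=> //=; first by case: i {lt_im lt_i}.
by case: q => //=; rewrite modn_small //; apply: leq_ltn_trans lt_im.
Qed.

Lemma growth_J_cvg n : growth (J m) n @[m --> \oo] --> ((n + 1) * (n + 2)) %/ 2.
Proof.
apply/discrete_cvg; exists n.+2 => // m /= lt_nm.
by rewrite growth_J ?card_normal_forms_small //; lia.
Qed.

(** The functions [3 n] and [(n + 1)(n + 2) / 2] still agree at 1 and 2; at 3 they
    are 9 and 10. *)
Lemma growth_Jlim_neq g :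
  (forall n : nat, growth (J m) n @[m --> \oo] --> g n) ->
  ~ (growth Jlim =1 g).
Proof.
move=> cvg_g eq_g.
have /discrete_cvg near_g := cvg_g 3; have /discrete_cvg near_10 := growth_J_cvg 3.
have [m [/= eq_m eq_m10]] := filter_ex (filterI near_g near_10).
move: (eq_g 3); rewrite -eq_m eq_m10.
by rewrite (growth_similar _ _ _ _ _ _ _ similar_Jprime_Jlim) ?growth_Jprime //; apply: finite_products_Jprime.
Qed.

Theorem theorem2p8 :
  (forall m : nat, 2 <= m -> growth_lt (growth (J m.+1)) (growth (J m)))
  /\
  (forall n : nat,
     growth (J m) n @[m --> \oo] --> ((n + 1) * (n + 2)) %/ 2)
  /\
  (exists L : mealy nat jstate,
     [/\ pointwise_limit J L,
         similar Jprime L,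
         has_presentation Jprime Jprime_rel,
         (forall n : nat, 1 <= n -> monoid_growth Jprime n = 3 * n) &
         (forall g : nat -> nat,
            (forall n : nat, growth (J m) n @[m --> \oo] --> g n) ->
            ~ (growth L =1 g))]).
Proof.
split; first exact: growth_J_lt.
split; first exact: growth_J_cvg.
exists Jlim; split.
- exact: pointwise_limit_Jlim.
- exact: similar_Jprime_Jlim.
- exact/has_presentation_of_congr/congr_JprimeP.
- move=> n n_gt0; rewrite (monoid_growthE _ _ _ Je) ?growth_Jprime //.
  exact: transf_Jprime_Je.
- exact: growth_Jlim_neq.
Qed.
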